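(* Let $\Gamma$ be a class of topological spaces and assume $\mathtt{OGD}^{\mathbb{N}}(\Gamma)$. Suppose that $X$ is a metric space and $Y\subseteq X$ is in $\Gamma$. Then exactly one of the following holds: (1) the set $Y$ is contained in a $K_\sigma$ subset of $X$; (2) there is a closed continuous injection $\phi\colon\mathbb{N}^{\mathbb{N}}\to X$ with the property that $\phi(\mathbb{N}^{\mathbb{N}})\subseteq Y$.
   Context: Base theory: $\mathsf{ZF}+\mathsf{DC}$. A subset of a topological space is $K_\sigma$ if it is a countable union of compact sets. A map is closed if images of closed sets are closed. $Y\in\Gamma$ refers to $Y$ with the subspace topology. Definition of $\mathtt{OGD}^{\mathbb{N}}(\Gamma)$: for every $Z\in\Gamma$ and every box-open $\mathbb{N}$-dimensional dihypergraph $H$ on $Z$, either $H$ has chromatic number at most $\aleph_0$ or there is a continuous homomorphism from $\mathbb{H}_{\mathbb{N}^{\mathbb{N}}}$ to $H$. Here an $\mathbb{N}$-dimensional dihypergraph on $Z$ is a subset of $Z^{\mathbb{N}}$ containing no constant sequence; it is box-open if it is open in the topology on $Z^{\mathbb{N}}$ generated by the sets $\prod_n U_n$ with all $U_n\subseteq Z$ open; a homomorphism from $R\subseteq W^{\mathbb{N}}$ to $S\subseteq Z^{\mathbb{N}}$ is a map $\pi\colon W\to Z$ sending, coordinatewise, elements of $R$ to elements of $S$; the chromatic number of $H$ is the least cardinal $\kappa$ for which there is a map from $Z$ to a set of cardinality $\kappa$ that is non-constant along every element of $H$; and $\mathbb{H}_{\mathbb{N}^{\mathbb{N}}}=\bigcup_{t\in\mathbb{N}^{<\mathbb{N}}}\prod_{n\in\mathbb{N}}\mathcal{N}_{t\cdot(n)}$,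 where $\mathcal{N}_s=\{b\in\mathbb{N}^{\mathbb{N}} : s\sqsubseteq b\}$ and $t\cdot(n)$ is $t$ followed by the single entry $n$. *)

(* Defs.v *)
From HB Require Import structures.
From mathcomp Require Import all_boot all_order all_algebra.
From mathcomp Require Import all_classical all_reals all_analysis.

Set Implicit Arguments.
Unset Strict Implicit.
Unset Printing Implicit Defensive.

Local Open Scope classical_set_scope.
Local Open Scope card_scope.

Definition baire_space : Type := prod_topology (fun _ : nat => nat).

HB.instance Definition _ := Topological.on baire_space.

Definition cylinder (s : seq nat) : set baire_space :=
  [set b | mkseq b (size s) = s].

Definition box_sequence (Z : Type) : Type := nat -> Z.

Section box_topology.
Context (Z : topologicalType).

Definition open_sides : set (nat -> set Z) := [set U | forall n, open (U n)].

Definition box (U : nat -> set Z) : set (box_sequence Z) :=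
  [set x | forall n, U n (x n)].

Lemma box_cover : \bigcup_(U in open_sides) box U = setT.
Proof.
by apply/seteqP; split => // x _; exists (fun=> setT) => // n; exact: openT.
Qed.

Lemma box_join (U V : nat -> set Z) (x : box_sequence Z) :
  open_sides U -> open_sides V -> box U x -> box V x ->
  exists W, [/\ open_sides W, box W x & box W `<=` box U `&` box V].
Proof.
move=> oU oV Ux Vx; exists (fun n => U n `&` V n); split=> [n|n|y Wy].
- exact: openI.
- by split.
- by split=> n; case: (Wy n).
Qed.

HB.instance Definition _ := Choice.copy (box_sequence Z) (nat -> Z).
HB.instance Definition _ :=
  isBaseTopological.Build (box_sequence Z) box_cover box_join.

End box_topology.

Definition dihypergraph (Z : Type) (H : set (nat -> Z)) : Prop :=
  forall z, ~ H (fun=> z).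

Definition box_open (Z : topologicalType) (H : set (nat -> Z)) : Prop :=
  open (H : set (box_sequence Z)).

Definition homomorphism (W Z : Type) (R : set (nat -> W)) (S : set (nat -> Z))
  (f : W -> Z) : Prop := forall x, R x -> S (f \o x).

Definition colorable (Z : Type) (H : set (nat -> Z)) (C : Type) : Prop :=
  exists c : Z -> C, forall x, H x -> ~ exists k, forall n, c (x n) = k.

(* The chromatic number of H is the cardinality of the type C. *)
Definition chromatic_number (Z : Type) (H : set (nat -> Z)) (C : Type) : Prop :=
  colorable H C /\
  forall C' : Type, colorable H C' -> [set: C] #<= [set: C'].

Definition chromatic_number_at_most_aleph0 (Z : Type) (H : set (nat -> Z)) :
  Prop := exists2 C : Type, chromatic_number H C & [set: C] #<= [set: nat].

Definition HNN : set (nat -> baire_space) :=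
  \bigcup_(t in [set: seq nat]) [set x | forall n, cylinder (rcons t n) (x n)].

Definition OGDN (Gamma : topologicalType -> Prop) : Prop :=
  forall Z : topologicalType, Gamma Z ->
  forall H : set (nat -> Z), dihypergraph H -> box_open H ->
    chromatic_number_at_most_aleph0 H \/
    exists2 f : baire_space -> Z, continuous f & homomorphism HNN H f.

Definition Ksigma (T : topologicalType) (S : set T) : Prop :=
  exists2 K : (set T)^nat, (forall n, compact (K n)) & S = \bigcup_n K n.

Definition closed_map (S T : topologicalType) (f : S -> T) : Prop :=
  forall A : set S, closed A -> closed (f @` A).

(* Main.v *)
(* Let H be the set of sequences in Y with no accumulation point in X; it is
   box-open because moving the n-th term by less than 1/(n+1) preserves the
   accumulation points.  If H is countably colorable, every sequence in a color
   class accumulates somewhere in X, so the color classes have compact closures.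
   Otherwise let f be a continuous homomorphism.  For every s and y, some
   neighborhood of y misses the f-image of the cylinder N_{s.n} for all large n
   (f is "spreading"), and König's lemma makes f closed.  Spreading also allows
   shrinking the cylinders N_{s.k_n} for a sparse (k_n) so that their images are
   disjoint; iterating gives a closed copy of Baire space on which f is
   injective.
   The alternatives exclude each other because a compact set misses the image of
   some N_{s.m} under a closed injection, so a branch escaping countably many
   compact sets can be built by diagonalization. *)
Require Import Defs.
From mathcomp Require Import all_boot all_order all_algebra.
From mathcomp Require Import all_classical all_reals all_analysis.

Set Implicit Arguments.
Unset Strict Implicit.
Unset Printing Implicit Defensive.

Import Order.TTheory GRing.Theory Num.Theory.

Local Open Scope classical_set_scope.

(** * Cylinders as a neighborhood basis of Baire space *)

Lemma cylinderP (s : seq nat) (b : baire_space) :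
  cylinder s b <-> forall i, i < size s -> b i = nth 0 s i.
Proof.
split=> [sb i si|sb]; first by rewrite -[in RHS]sb nth_mkseq.
apply: (@eq_from_nth _ 0) => [|i]; rewrite size_mkseq// => si.
by rewrite nth_mkseq// sb.
Qed.

Lemma cylinder_mkseq (b c : baire_space) (n : nat) :
  cylinder (mkseq b n) c <-> forall i, i < n -> c i = b i.
Proof.
split=> [/cylinderP bc i ni|bc].
  by rewrite bc ?size_mkseq// nth_mkseq.
by apply/cylinderP => i; rewrite size_mkseq => ni; rewrite nth_mkseq// bc.
Qed.

Lemma cylinder_nth (s : seq nat) : cylinder s (nth 0 s).
Proof. exact: mkseq_nth. Qed.

Lemma cylinder_rcons (s : seq nat) (n : nat) (b : baire_space) :
  cylinder (rcons s n) b <-> cylinder s b /\ b (size s) = n.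
Proof.
rewrite /cylinder /= size_rcons mkseqS; split=> [/rcons_inj[]//|[-> ->]//].
Qed.

Lemma cylinder_prefix (s t : seq nat) :
  prefix s t -> cylinder t `<=` cylinder s.
Proof.
move=> /prefixP[r ->] b /cylinderP sb; apply/cylinderP => i si.
by rewrite sb ?nth_cat ?si // size_cat ltn_addr.
Qed.

Lemma nbhs_cylinder (b : baire_space) (U : set baire_space) :
  nbhs b U <-> exists n, cylinder (mkseq b n) `<=` U.
Proof.
split=> [|[n bU]].
  pose F := filter_from [set: nat] (fun n => cylinder (mkseq b n)).
  have FF : Filter F.
    apply: filter_from_filter; first by exists 0.
    move=> i j _ _; exists (maxn i j) => // c /cylinder_mkseq cb.
    by split; apply/cylinder_mkseq => k ki; apply: cb; rewrite leq_max ki ?orbT.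
  suff Fb : F --> b by move=> /Fb[n _ bU]; exists n.
  apply/cvg_sup => i A /=.
  move=> [_ [[C _ <-] Cb CA]]; exists i.+1 => // c /cylinder_mkseq cb.
  by apply: CA; rewrite /= cb.
suff : nbhs b [set c : baire_space | forall i : 'I_n, c i = b i].
  apply: filterS => c cb; apply: bU; apply/cylinder_mkseq => i ni.
  exact: cb (Ordinal ni).
apply: (@filter_forall _ _ (fun (i : 'I_n) (c : baire_space) => c i = b i)
  (nbhs b) _).
move=> i; have : nbhs (proj (nat_of_ord i) b) [set b i] by exact: discrete_set1.
by move=> /(@proj_continuous _ (fun _ : nat => nat)).
Qed.

Lemma open_prefix (A : set baire_space) (n : nat) :
  (forall b c : baire_space, (forall i, i < n -> b i = c i) -> A b -> A c) ->
  open A.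
Proof.
move=> An; rewrite openE => b Ab; apply/nbhs_cylinder; exists n.
by move=> c /cylinder_mkseq cb; apply: An Ab => i /cb.
Qed.

Definition clusterless (T : topologicalType) (z : nat -> T) : Prop :=
  forall y : T, exists2 U, nbhs y U & \forall n \near \oo, ~ U (z n).

Definition spreading (T : topologicalType) (f : baire_space -> T) : Prop :=
  forall s (y : T), exists2 U, nbhs y U &
    \forall n \near \oo, forall b, cylinder (rcons s n) b -> ~ U (f b).

Lemma not_clusterless (T : topologicalType) (z : nat -> T) :
  ~ clusterless z ->
  exists y : T, forall U N, nbhs y U -> exists2 n, N <= n & U (z n).
Proof.
move=> /existsNP[y /forall2NP zy]; exists y => U N yU.
have [//|{}zy] := zy U; apply: contrapT => zU; apply: zy.
by exists N => // n /= Nn Uz; apply: zU; exists n.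
Qed.

(** * Continuous spreading maps into Hausdorff spaces are closed *)

Section spreading_closed.
Variables (T : topologicalType) (f : baire_space -> T).
Hypotheses (sf : spreading f) (cf : continuous f) (hT : hausdorff_space T).

(** This is the step of König's lemma: by spreading, only finitely many children of [s] have images
    near [y], and the closure of a finite union is the union of the closures. *)
Lemma closure_cylinder (A : set baire_space) (s : seq nat) (y : T) :
  closure (f @` (A `&` cylinder s)) y ->
  exists n, closure (f @` (A `&` cylinder (rcons s n))) y.
Proof.
move=> sy; have [U yU [N _ NU]] := sf s y.
apply: contrapT => /forallNP noy.
have : \forall x \near y, forall n : 'I_N,
    ~ (f @` (A `&` cylinder (rcons s n))) x.
  apply: filter_forall => n.
  have /existsNP[V /not_implyP[yV AV]] := noy n.
  by apply: filterS yV => x Vx Ax; apply: AV; exists x.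
move=> /(filterI yU)/sy[_ [[b [Ab sb] <-] [Ub nb]]].
have bb : cylinder (rcons s (b (size s))) b by apply/cylinder_rcons.
have [bN|Nb] := ltnP (b (size s)) N; last exact: NU Nb b bb Ub.
by apply: (nb (Ordinal bN)); exists b.
Qed.

Lemma spreading_closed : closed_map f.
Proof.
move=> A clA y yA.
have /choice[next nextP] s : exists n, closure (f @` (A `&` cylinder s)) y ->
    closure (f @` (A `&` cylinder (rcons s n))) y.
  have [/closure_cylinder[n ny]|noy] :=
    pselect (closure (f @` (A `&` cylinder s)) y); first by exists n.
  by exists 0 => /noy.
pose t n := iter n (fun s => rcons s (next s)) [::].
pose b : baire_space := fun n => next (t n).
have tb n : mkseq b n = t n by elim: n => //= n IH; rewrite mkseqS IH.
have bA n : closure (f @` (A `&` cylinder (mkseq b n))) y.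
  rewrite tb; elim: n => [|n IH] /=; last exact: nextP.
  have -> : cylinder [::] = setT by apply/seteqP; split => // c _.
  by rewrite setIT.
have Ab : A b.
  apply: clA => U /nbhs_cylinder[n nU].
  have [_ [[c [Ac /nU Uc] _] _]] := bA n _ filterT.
  by exists c.
(* Every neighborhood of [f b] contains the image of a cylinder along [b], hence meets every
   neighborhood of [y]. *)
exists b => //; apply/hT => U V /cf/nbhs_cylinder[n nU] /(bA n).
by move=> [_ [[c [_ /nU Uc] <-] Vc]]; exists (f c).
Qed.

End spreading_closed.

(** * Thinning a spreading map to an injective one *)

Section scheme.
Variables (T : topologicalType) (f : baire_space -> T).
Hypotheses (sf : spreading f) (cf : continuous f).

Lemma spreading_split (s : seq nat) : exists u : nat -> seq nat,
  (forall n, exists2 k, n <= k & prefix (rcons s k) (u n)) /\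
  (forall m n b c, m < n -> cylinder (u m) b -> cylinder (u n) c ->
    f b <> f c).
Proof.
have /choice[v vP] k : exists v : seq nat * nat, [/\ prefix (rcons s k) v.1,
    k < v.2 & forall n b c, v.2 <= n -> cylinder v.1 b ->
      cylinder (rcons s n) c -> f b <> f c].
  (* The base point is [rcons s k] continued by zeros. Enough of these zeros are appended to force
     the image of the cylinder into [U], which the images of all children from [N] on miss. The
     bound [k.+1] makes the iterated thresholds strictly increase. *)
  have [U fU [N _ NU]] := sf s (f (nth 0 (rcons s k))).
  move: fU => /cf/nbhs_cylinder[n nU].
  exists (rcons s k ++ nseq n 0, maxn k.+1 N).
  split=> /= [||m b c]; [exact: prefix_prefix|by rewrite leq_max ltnSn|].
  rewrite geq_max => /andP[_ Nm] /cylinderP vb mc fbc.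
  apply: (NU m Nm c mc); rewrite -fbc; apply: nU; apply/cylinder_mkseq => i ni.
  rewrite vb ?size_cat ?size_nseq ?ltn_addl// nth_cat.
  by case: ltnP => // ki; rewrite nth_nseq if_same nth_default.
(* [k n.+1] is so large that, for [j >= k n.+1], the images of the cylinder of
   [(v (k n)).1] and of the cylinder of [rcons s j] are disjoint. *)
pose k n := iter n (fun k => (v k).2) 0.
have kS m n : m < n -> (v (k m)).2 <= k n.
  elim: n => // n IH; rewrite ltnS leq_eqVlt => /predU1P[-> //|/IH mn].
  by apply: leq_trans mn _; apply: ltnW; have [] := vP (k n).
exists (fun n => (v (k n)).1); split=> [n|m n b c mn mb nc].
  exists (k n); last by have [] := vP (k n).
  elim: n => // n IH; apply: leq_ltn_trans IH _.
  by have [] := vP (k n).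
have [_ _ /(_ (k n) b c (kS _ _ mn) mb)] := vP (k m); apply.
by have [+ _ _] := vP (k n) => /cylinder_prefix; apply.
Qed.

(** [spreading_split] is iterated along the tree. Spreading passes to the composite, so that
    [spreading_closed] applies to it directly and closedness of [psi] never has to be stated. *)
Lemma spreading_inj : exists psi : baire_space -> baire_space,
  [/\ continuous psi, spreading (f \o psi) & injective (f \o psi)].
Proof.
have /choice[u uP] := spreading_split.
pose t := foldl u [::].
have tS s n : t (rcons s n) = u (t s) n by rewrite /t foldl_rcons.
have tk s n : exists2 k, n <= k & prefix (rcons (t s) k) (t (rcons s n)).
  by rewrite tS; have [] := uP (t s).
have tprefix s n : prefix (t s) (t (rcons s n)).
  have [k _] := tk s n; apply: prefix_trans; exact: prefix_rcons.
have tsize s : size s <= size (t s).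
  elim/last_ind: s => // s n IH; have [k _ /prefixP[r ->]] := tk s n.
  by rewrite size_cat !size_rcons addSn ltnS (leq_trans IH) ?leq_addr.
(* By [tsize] the position [i] lies inside the list, so the default 0 is never read. *)
pose psi (b : baire_space) : baire_space := fun i => nth 0 (t (mkseq b i.+1)) i.
have tmono (b : baire_space) i j : i <= j ->
    prefix (t (mkseq b i)) (t (mkseq b j)).
  elim: j => [|j IH]; first by rewrite leqn0 => /eqP->; exact: prefix_refl.
  rewrite leq_eqVlt => /predU1P[->|/IH]; first exact: prefix_refl.
  by move=> /prefix_trans; apply; rewrite mkseqS.
have psiP s b : cylinder s b -> cylinder (t s) (psi b).
  move=> <-; apply/cylinderP => i si; rewrite /psi.
  have si' : i < size (t (mkseq b i.+1)).
    by apply: leq_trans (tsize _); rewrite size_mkseq.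
  have [/(tmono b)|/ltnW/(tmono b)] := leqP i.+1 (size s).
    by move=> /prefixP[r ->]; rewrite nth_cat si'.
  by move=> /prefixP[r ->]; rewrite nth_cat si.
exists psi; split.
- move=> b U /nbhs_cylinder[n nU]; apply/nbhs_cylinder; exists n => c.
  move=> /cylinder_mkseq cb; apply: nU; apply/cylinder_mkseq => i ni.
  rewrite /psi; congr (nth _ (t _) _); apply/eq_in_map => j.
  by rewrite mem_iota /= add0n => ji; apply: cb; apply: leq_trans ji ni.
- move=> s y; have [U yU [N _ NU]] := sf (t s) y; exists U => //.
  exists N => // n Nn b /psiP sb; have [k nk kt] := tk s n.
  by apply: (NU k); [exact: leq_trans nk|exact: cylinder_prefix sb].
- move=> b c fbc; apply: contrapT => bc.
  (* At the first disagreement both branches pass through the same node, whose children have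
     disjoint images. *)
  have [i bci imin] : exists2 i, b i != c i & forall j, j < i -> b j = c j.
    have exi : exists i, b i != c i.
      apply: contrapT => /forallNP beqc; apply: bc; apply/funext => i.
      by apply/eqP/negPn/negP/beqc.
    exists (ex_minn exi); case: ex_minnP => // i _ imin j ji.
    by apply/eqP/negPn/negP => /imin; rewrite leqNgt ji.
  have bi : cylinder (u (t (mkseq b i)) (b i)) (psi b).
    by rewrite -tS -mkseqS; apply: psiP; apply/cylinder_mkseq.
  have ci : cylinder (u (t (mkseq b i)) (c i)) (psi c).
    rewrite -tS; apply: psiP; apply/cylinder_rcons; rewrite size_mkseq.
    by split=> //; apply/cylinder_mkseq => j /imin.
  have [_ disj] := uP (t (mkseq b i)).
  have [ltbc|ltcb|eqbc] := ltngtP (b i) (c i).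
  + exact: disj ltbc bi ci fbc.
  + exact: disj ltcb ci bi (esym fbc).
  + by rewrite eqbc eqxx in bci.
Qed.

End scheme.

(** * Incompatibility of the two alternatives *)

(** The images of the sets [A N] are closed and decreasing, and injectivity makes their intersection
    empty. Their complements thus form an increasing open cover of [K], and a single [N] suffices by
    compactness. *)
Lemma compact_avoids_cylinder (T : topologicalType) (f : baire_space -> T)
    (K : set T) (s : seq nat) :
  closed_map f -> injective f -> compact K ->
  exists m, forall b, cylinder (rcons s m) b -> ~ K (f b).
Proof.
move=> clf injf /compact_near_coveringP cK.
pose A N := cylinder s `&` [set b : baire_space | N <= b (size s)].
have clA N : closed (A N).
  rewrite -openC; apply: (@open_prefix _ (size s).+1) => b c bc nb [sc Nc].
  apply: nb; split; last by rewrite /= bc.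
  move: sc => /cylinderP sc; apply/cylinderP => i si.
  by rewrite bc ?sc // ltnW.
have [x Kx|N _ NK] := cK nat \oo (fun N x => ~ (f @` A N) x) _.
  have [[b sb bx]|nx] := pselect ((f @` A 0) x).
    exists (~` (f @` A (b (size s)).+1), [set n | (b (size s)).+1 <= n]).
      split => /=; last by exists (b (size s)).+1.
      apply: open_nbhs_nbhs; split.
        by rewrite openC; exact: clf.
      by move=> [c [sc cb]]; rewrite -bx => /injf cE; rewrite cE /= ltnn in cb.
    move=> [z n] /= [nz bn] [c [sc cn] cz]; apply: nz; exists c => //.
    by split=> //; exact: leq_trans cn.
  exists (~` (f @` A 0), setT).
    split => /=; last exact: filterT.
    by apply: open_nbhs_nbhs; split => //; rewrite openC; exact: clf.
  by move=> [z n] /= [nz _] [c [sc _] cz]; apply: nz; exists c.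
exists N => b /cylinder_rcons[sb bN] Kb.
by apply: (NK N (leqnn N) _ Kb); exists b => //; split=> //; rewrite /= bN.
Qed.

Lemma closed_injection_not_Ksigma (T : topologicalType) (f : baire_space -> T)
    (S : set T) :
  closed_map f -> injective f -> Ksigma S -> ~ range f `<=` S.
Proof.
move=> clf injf [K cK ->] fS.
(* The length of [s] selects the compact set to escape, so the branch built from [next] avoids the
   n-th one at its n-th entry. *)
have /choice[next nextP] s : exists m, forall b, cylinder (rcons s m) b ->
    ~ K (size s) (f b) by exact: compact_avoids_cylinder.
pose t n := iter n (fun s => rcons s (next s)) [::].
pose b : baire_space := fun n => next (t n).
have tb n : mkseq b n = t n by elim: n => //= n IH; rewrite mkseqS IH.
have [|n _] := fS (f b); first by exists b.
have : cylinder (rcons (t n) (next (t n))) b.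
  by rewrite -/(b n) -tb -mkseqS; apply/cylinder_mkseq.
by move=> /nextP; rewrite -tb size_mkseq.
Qed.

(** * Spreading, precompactness and box-openness in metric spaces *)

Section metric.
Variables (R : realType) (X : metricType R).

Lemma spreading_of_fans (f : baire_space -> X) :
  (forall s (x : nat -> baire_space), (forall n, cylinder (rcons s n) (x n)) ->
    clusterless (f \o x)) ->
  spreading f.
Proof.
move=> fans s y.
(* Each [x n] nearly minimizes the distance to [y] over its cylinder, so this one clusterless fan
   keeps the entire images of almost all the cylinders away from [y]. *)
have /choice[x xP] (n : nat) : exists x, cylinder (rcons s n) x /\
    forall b, cylinder (rcons s n) b ->
      (mdist y (f x) < mdist y (f b) + n.+1%:R^-1)%R.
  pose E := [set mdist y (f b) | b in cylinder (rcons s n)].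
  have lbE : lbound E 0%R by move=> _ [b _ <-]; exact: mdist_ge0.
  have infE : has_inf E.
    split; last by exists 0%R.
    by exists (mdist y (f (nth 0 (rcons s n)))), (nth 0 (rcons s n)) => //;
      exact: cylinder_nth.
  have n0 : (0 < n.+1%:R^-1 :> R)%R by rewrite invr_gt0 ltr0n.
  have [_ [x sx <-] xinf] := inf_adherent n0 infE.
  exists x; split=> // b sb; apply: lt_le_trans xinf _; rewrite lerD2r.
  by apply: ge_inf; [case: infE|exists b].
have [|U /nbhs_ballP[e /= e0 eU] Ux] := fans s x _ y.
  by move=> n; case: (xP n).
have e20 : (0 < e / 2)%R by rewrite divr_gt0.
exists (ball y (e / 2)); first exact: nbhsx_ballx.
have := near_infty_natSinv_lt (PosNum e20).
apply: filterS2 Ux => n Ux /= ne b sb; rewrite ballEmdist /= => yb.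
apply: Ux; apply: eU; rewrite ballEmdist /=.
have [_ /(_ b sb) /lt_trans] := xP n; apply.
by rewrite [ltRHS]splitr; exact: ltrD.
Qed.

Section precompact.
Variable (S : set X).
Hypothesis clS : forall z : nat -> X, (forall n, S (z n)) -> ~ clusterless z.

(* Otherwise no finite union of [e]-balls centered in [S] belongs to [U], which
   yields a sequence in [S] that is e/2-separated and thus clusterless. *)
Lemma ultra_small_ball (U : set_system X) (e : R) :
  UltraFilter U -> U (closure S) -> (0 < e)%R -> exists2 c, S c & U (ball c e).
Proof.
move=> UU US e0; apply: contrapT => /forall2NP noc.
have e20 : (0 < e / 2)%R by rewrite divr_gt0.
have e40 : (0 < e / 2 / 2)%R by rewrite divr_gt0.
(* The complement of the [e]-balls around [l] belongs to [U] and so meets [closure S]; moving the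
   point found there into [S] costs half of the separation. *)
have far (l : seq X) : {in l, forall d, S d} -> exists c, S c /\
    {in l, forall d, ~ ball d (e / 2) c}.
  move=> lS.
  have Ul : U [set x | {in l, forall d, ~ ball d e x}].
    elim: l lS => [_|d l IH dlS]; first exact: filterS filterT.
    have lS : {in l, forall d, S d}.
      by move=> a al; apply: dlS; rewrite inE al orbT.
    have Sd : S d by apply: dlS; rewrite inE eqxx.
    have Ud : U (~` ball d e).
      by have [] := in_ultra_setVsetC (ball d e) UU; have [] := noc d.
    apply: filterS2 Ud (IH lS) => x dx lx a; rewrite inE => /predU1P[->//|].
    exact: lx.
  have [x [Sx lx]] := filter_ex (filterI US Ul).
  have [c [Sc xc]] := Sx _ (nbhsx_ballx x _ e20).
  exists c; split=> // d dl dc; apply: (lx d dl); rewrite [e]splitr.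
  by apply: ball_triangle dc _; exact: ball_sym.
have [c0 _] := far [::] (fun _ => ltac:(by [])).
have /choice[g gP] (l : seq X) : exists c : X, {in l, forall d, S d} ->
    S c /\ {in l, forall d, ~ ball d (e / 2) c}.
  have [/far[c cP]|nS] := pselect {in l, forall d, S d}; first by exists c.
  by exists c0.
pose t n := iter n (fun l => g l :: l) [::].
have tS n : {in t n, forall d, S d}.
  elim: n => // n IH d; rewrite inE => /predU1P[->|/IH//].
  by have [] := gP _ IH.
have tin m n : m < n -> g (t m) \in t n.
  elim: n => // n IH; rewrite ltnS leq_eqVlt inE => /predU1P[->|/IH ->].
    by rewrite eqxx.
  by rewrite orbT.
have [|y yP] := not_clusterless (clS (z := g \o t) _).
  by move=> n; have [] := gP _ (tS n).
(* Two terms within [e / 2 / 2] of [y] would be less than [e / 2] apart. *)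
have [m _ ym] := yP _ 0 (nbhsx_ballx y _ e40).
have [n mn yn] := yP _ m.+1 (nbhsx_ballx y _ e40).
have [_ /(_ _ (tin _ _ mn))] := gP _ (tS n); apply.
by rewrite [(e / 2)%R]splitr; apply: ball_triangle yn; exact: ball_sym.
Qed.

(** An ultrafilter containing [closure S] contains arbitrarily small balls centered in [S]; an
    accumulation point of their centers is a limit of the ultrafilter. *)
Lemma compact_closure_of_cluster : compact (closure S).
Proof.
rewrite compact_ultra => U UU US.
have /choice[c cP] (n : nat) : exists c, S c /\ U (ball c (n.+1%:R^-1)%R).
  have n0 : (0 < n.+1%:R^-1 :> R)%R by rewrite invr_gt0 ltr0n.
  by have [c] := ultra_small_ball UU US n0; exists c.
have [|y yP] := not_clusterless (clS (z := c) _).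
  by move=> n; case: (cP n).
have Uy : U --> y.
  move=> A /nbhs_ballP[e /= e0 eA].
  have e20 : (0 < e / 2)%R by rewrite divr_gt0.
  have [N _ Ne] := near_infty_natSinv_lt (PosNum e20).
  have [n Nn yn] := yP _ N (nbhsx_ballx y _ e20).
  have [_] := cP n; apply: filterS => x cx; apply: eA.
  rewrite [e]splitr; apply: ball_triangle yn _.
  by apply: le_ball cx; apply/ltW/Ne.
exists y; split=> //; apply: closed_closure => A /Uy UA.
exact: filter_ex (filterI US UA).
Qed.

End precompact.

Lemma clusterless_box_open (Y : set X) :
  box_open [set x : nat -> set_type Y | clusterless (fun n => set_val (x n))].
Proof.
set H := [set x | _].
exists [set U | open_sides U /\ box U `<=` H]; first by move=> U [].
apply/seteqP; split=> [x [U [_ UH] /UH//]|x xH].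
(* The radii tend to 0, so for large [n] a term of the perturbed sequence near [y] would bring [x n]
   near [y] as well; interiors make the sides of the box open. *)
pose B n := ((ball (set_val (x n)) n.+1%:R^-1%R)° : set X).
exists (fun n => set_val @^-1` B n); last first.
  move=> n; rewrite /preimage /=; apply: (@nbhsx_ballx R X).
  by rewrite invr_gt0 ltr0n.
split=> [n|z zB y]; first by exists (B n) => //; exact: open_interior.
have [U /nbhs_ballP[e /= e0 eU] Ux] := xH y.
have e20 : (0 < e / 2)%R by rewrite divr_gt0.
exists (ball y (e / 2)); first exact: nbhsx_ballx.
have := near_infty_natSinv_lt (PosNum e20).
apply: filterS2 Ux => n Ux /= ne yz; apply: Ux; apply: eU.
rewrite [e]splitr; apply: ball_triangle yz _; apply: ball_sym.
exact: le_ball (ltW ne) _ (interior_subset (zB n)).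
Qed.

End metric.

Theorem theorem2p2 (Gamma : topologicalType -> Prop) (hGamma : OGDN Gamma)
    (R : realType) (X : metricType R) (Y : set X)
    (hY : Gamma (set_type Y : topologicalType)) :
  let P1 := exists2 S : set X, Ksigma S & Y `<=` S in
  let P2 := exists phi : baire_space -> X,
    [/\ closed_map phi, continuous phi, injective phi & range phi `<=` Y] in
  (P1 \/ P2) /\ ~ (P1 /\ P2).
Proof.
move=> P1 P2; split; last first.
  move=> [[S KS YS] [f [clf _ injf fY]]].
  exact: closed_injection_not_Ksigma clf injf KS (subset_trans fY YS).
pose H := [set x : nat -> set_type Y | clusterless (fun n => set_val (x n))].
have diH : dihypergraph H.
  move=> z /(_ (set_val z))[U zU [N _ /(_ N (leqnn N))]]; apply.
  exact: nbhs_singleton.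
have oH : box_open H by exact: clusterless_box_open.
have [[C [[c cH] _] /countable_injP[g ginj]]|[f cf Hf]] := hGamma _ hY H diH oH.
  left; pose K n := closure (set_val @` [set y : set_type Y | g (c y) = n]).
  exists (\bigcup_n K n); last first.
    move=> y Yy; exists (g (c (SigSub (mem_set Yy)))) => //.
    by apply: subset_closure; exists (SigSub (mem_set Yy)).
  (* A clusterless sequence in one color class lifts to an element of [H] along which the coloring
     is constant. *)
  exists K => // n; apply: compact_closure_of_cluster => z zn zH.
  have /choice[x xz] m : exists y : set_type Y, g (c y) = n /\ set_val y = z m.
    by have [y yn yz] := zn m; exists y.
  apply: (cH x).
    by congr clusterless: zH; apply/funext => m; have [_ ->] := xz m.
  exists (c (x 0)) => m; apply: ginj; rewrite ?in_setT//.
  by have [-> _] := xz m; have [-> _] := xz 0.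
right; pose F b := set_val (f b).
have cF : continuous F.
  by move=> b; apply: continuous_comp; [exact: cf|exact: initial_continuous].
have sF : spreading F.
  (* A fan over [s] is an element of [HNN], so the homomorphism makes its image clusterless in
     [X]. *)
  apply: spreading_of_fans => s x sx; apply: (Hf x); by exists s.
have [psi [cpsi spsi ipsi]] := spreading_inj sF cF.
have cFpsi : continuous (F \o psi).
  by move=> b; apply: continuous_comp; [exact: cpsi|exact: cF].
exists (F \o psi); split=> //.
  exact: spreading_closed spsi cFpsi (@metric_hausdorff _ _).
by move=> _ [b _ <-]; exact: set_valP.
Qed.
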